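(* Let $F$ be a universal system over $\mathbb Q$ and $K$ a filtered face set. Then the perverse cochain complex of global sections $\widetilde F(K)_\bullet$ and its cohomology $H(\widetilde F(K)_\bullet)$ (with zero differential) are balanced.
   Context: All vector spaces are over $\mathbb Q$. Fix $n$. Filtered face sets: let $\mathbf\Delta^{[n]}_{\mathcal F}$ be the category whose objects are the joins $\Delta=\Delta^{j_0}*\cdots*\Delta^{j_n}$ with $j_i\ge -1$ (conventions $\Delta^{-1}=\emptyset$, $\emptyset*X=X$; not all factors empty) and whose morphisms are joins $*_i\sigma_i$ where each $\sigma_i\colon\Delta^{j_i}\to\Delta^{k_i}$ is induced by an injective order-preserving map of vertices, or is $\emptyset\to\Delta^{k_i}$. A filtered face set is a contravariant functor $K$ from $\mathbf\Delta^{[n]}_{\mathcal F}$ to sets; its elements are simplices $\sigma\colon\Delta^{j_0}*\cdots*\Delta^{j_n}\to K$; $K_+$ denotes the simplices with $j_n\ge0$. Universal system: a contravariant functor $F$ from the category of the $[m]=\{0,\dots,m\}$ (identified with $\Delta^m$) and injective order-preserving maps to (non-negatively graded) cochain complexes. Blow-up: write $c\Delta^j=\Delta^{j+1}$ for the cone on $\Delta^j$, with cone point the last vertex ($c\emptyset=\Delta^0$), and $\Delta^j\times\{1\}$ for its face opposite to the cone point. $\widetilde F(K)$ is the cochain complex of families $\omega=(\omega_\sigma)_{\sigma\in K_+}$, $\omega_\sigma\in F(c\Delta^{j_0})\otimes\cdots\otimes F(c\Delta^{j_{n-1}})\otimes F(\Delta^{j_n})$, with $\omega_{\sigma\circ\delta}=\delta^*\omega_\sigma$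 for every morphism $\delta$ between objects with non-empty last factor. For $\ell\in\{1,\dots,n\}$: $\|\omega_\sigma\|_\ell=-\infty$ if $j_{n-\ell}=-1$; otherwise restrict the factor of index $n-\ell$ to $F(\Delta^{j_{n-\ell}}\times\{1\})$ and let $\|\omega_\sigma\|_\ell$ be the largest $d$ such that the component of the restriction of total degree $d$ in the last $\ell$ tensor factors is non-zero ($-\infty$ if the restriction is zero). $\|\omega\|_\ell=\sup_\sigma\|\omega_\sigma\|_\ell$. Perversities: a GM-perversity is a map $\overline q$ with $\overline q(0)=\overline q(1)=\overline q(2)=0$ and $\overline q(i)\le\overline q(i+1)\le\overline q(i)+1$ for $i\ge1$. $\mathcal P^n$ is the lattice of GM-perversities (functions on $\{0,\dots,n\}$), $\hat{\mathcal P}^n=\mathcal P^n\cup\{\overline\infty\}$ with $\overline\infty$ the constant map $\infty$. For $\overline q\in\hat{\mathcal P}^n$, $\widetilde F(K)_{\overline q}=\{\omega\in\widetilde F(K):\|\omega\|_\ell\le\overline q(\ell),\|d\omega\|_\ell\le\overline q(\ell)\ \forall\ell\}$, with inclusions as structure maps. A perverse cochain complex is a functor $\overline p\mapsto A_{\overline p}$ from the poset $\hat{\mathcal P}^n$ to cochain complexes, with structure maps $\varphi^{\overline p}_{\overline q}\colon A_{\overline q}\to A_{\overline p}$, $\overline q\le\overline p$. Peaks and predecessors: a peak of a GM-perversity $\overline p$ is an integer $j\in\{3,\dots,n-1\}$ with $\overline p(j+1)=\overline p(j)>\overline p(j-1)$, or $j=n$ if $\overline p(n)>\overline p(n-1)$.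 Let $\mathtt n_1<\dots<\mathtt n_s$ be the peaks; the predecessors of $\overline p$ are the GM-perversities $\overline p_i$ equal to $\overline p$ except $\overline p_i(\mathtt n_i)=\overline p(\mathtt n_i)-1$, ordered by their peaks. Balanced: a perverse cochain complex $A_\bullet$ is balanced if for any GM-perversity $\overline p$ and any ordered sequence $(\overline p_{\nu_1},\dots,\overline p_{\nu_j})$, $j\ge1$, $\nu_1<\dots<\nu_j$, of predecessors of $\overline p$: (a) with $\overline p_{\nu_i,\nu_\ell}=\inf(\overline p_{\nu_i},\overline p_{\nu_\ell})$, for $k\le\overline p(\mathtt n_{\nu_j})-j+1$ the sequence $\bigoplus_{1\le i<\ell\le j}A^k_{\overline p_{\nu_i,\nu_\ell}}\xrightarrow{\varphi}\bigoplus_{i=1}^jA^k_{\overline p_{\nu_i}}\xrightarrow{\psi}A^k_{\overline p}$ is exact (for $j=1$: $\psi$ is injective), where $\varphi$ sends $\beta\in A_{\overline p_{\nu_i,\nu_\ell}}$ to the tuple with $i$-th entry $\varphi^{\overline p_{\nu_i}}_{\overline p_{\nu_i,\nu_\ell}}(\beta)$, $\ell$-th entry $-\varphi^{\overline p_{\nu_\ell}}_{\overline p_{\nu_i,\nu_\ell}}(\beta)$ and other entries $0$, and $\psi(\alpha_1,\dots,\alpha_j)=\sum_i\varphi^{\overline p}_{\overline p_{\nu_i}}(\alpha_i)$; (b) $\varphi^{\overline p}_{\overline p_{\nu_j}}\colon A^0_{\overline p_{\nu_j}}\to A^0_{\overline p}$ is surjective if $\overline p(\mathtt n_{\nu_j})\ge2$;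 (c) for any GM-perversity $\overline q\le\overline p$, the maps $H^1(A_{\overline q})\to H^1(A_{\overline p})$ and $H^1(A_{\overline q})\to H^1(A_{\overline\infty})$ are injective. *)

(* Defs.v *)
From HB Require Import structures.
From mathcomp Require Import all_boot all_order all_algebra.
From mathcomp Require Import generic_quotient finmap.
From mathcomp.multinomials Require Import monalg.
From mathcomp Require Import zify.
From mathcomp Require Import boolp classical_sets constructive_ereal.

Set Implicit Arguments.
Unset Strict Implicit.
Unset Printing Implicit Defensive.
Import Order.TTheory GRing.Theory Num.Theory.
Local Open Scope ring_scope.
Local Open Scope quotient_scope.

Local Notation fext := functional_extensionality_dep.

(* Rational vector spaces: lmodType rat, naming the ring structure of rat
   explicitly because the elaborated form of lmodType rat hinders rewriting. *)
Notation vect := (lmodType rat_rat__canonical__GRing_PzRing).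

Definition lin (U V : vect) (f : U -> V) (fL : linear f) :
    {linear U -> V} :=
  HB.pack f (GRing.isLinear.Build rat U V *:%R f fL).

Record subspace (V : vect) := Subspace {
  smem :> V -> Prop;
  smem0 : smem 0;
  smemP : forall (a : rat) x y, smem x -> smem y -> smem (a *: x + y) }.

Section Sub.
Variables (V : vect) (S : subspace V).

Definition sub_pred : pred V := fun x => `[< S x >].

Lemma sub_pred_submod : submod_closed sub_pred.
Proof.
split; first by apply/asboolP; exact: smem0.
by move=> a x y /asboolP Sx /asboolP Sy; apply/asboolP; exact: smemP.
Qed.
HB.instance Definition _ :=
  GRing.isSubmodClosed.Build rat V sub_pred sub_pred_submod.

Definition sub_type := {x : V | x \in sub_pred}.
HB.instance Definition _ := SubChoice.on sub_type.
HB.instance Definition _ :=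
  GRing.SubChoice_isSubLmodule.Build rat V sub_pred sub_type sub_pred_submod.
Definition sub : vect := sub_type.

Lemma sub_memP x : reflect (S x) (x \in sub_pred).
Proof. exact: asboolP. Qed.

Lemma sub_memE (x : sub) : S (val x).
Proof. exact/sub_memP/(valP x). Qed.

Definition msub (x : V) (Sx : S x) : sub := exist _ x (introT (sub_memP x) Sx).

Lemma msubE x (Sx : S x) : val (msub Sx) = x. Proof. by []. Qed.
End Sub.

Lemma scalable_val (V : vect) (S : subspace V) a (x y : sub S) :
  val (a *: x + y) = a *: val x + val y.
Proof. by rewrite linearP. Qed.

Section SubMap.
Variables (V W : vect) (S : subspace V) (T : subspace W).
Variables (f : {linear V -> W}) (fST : forall x, S x -> T (f x)).

Definition sub_map_fun (x : sub S) : sub T := msub (fST (sub_memE x)).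

Lemma sub_map_linear : linear sub_map_fun.
Proof.
by move=> a x y; apply: val_inj; rewrite scalable_val /= linearP.
Qed.

Definition sub_map : {linear sub S -> sub T} := lin sub_map_linear.

Lemma sub_mapE x : val (sub_map x) = f (val x). Proof. by []. Qed.
End SubMap.

Section Quo.
Variables (V : vect) (S : subspace V).

Lemma smemN x : S x -> S (- x).
Proof. by move=> Sx; rewrite -scaleN1r -[_ *: _]addr0; exact/smemP/smem0. Qed.

Lemma smemD x y : S x -> S y -> S (x + y).
Proof. by move=> Sx Sy; rewrite -[x]scale1r; exact: smemP. Qed.

Lemma smemZ a x : S x -> S (a *: x).
Proof. by move=> Sx; rewrite -[_ *: _]addr0; exact/smemP/smem0. Qed.

Definition quo_rel (x y : V) := `[< S (x - y) >].

Lemma quo_rel_equiv : equiv_class_of quo_rel.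
Proof.
split=> [x|x y|y x z].
- by apply/asboolP; rewrite subrr; exact: smem0.
- by apply/asboolP/asboolP=> /smemN; rewrite opprB.
- move=> /asboolP Sxy /asboolP Syz; apply/asboolP.
  by rewrite -[x](subrK y) -addrA; exact: smemD.
Qed.

Canonical quo_equiv := EquivRelPack quo_rel_equiv.

Definition quo_type := {eq_quot quo_equiv}.
HB.instance Definition _ := Choice.on quo_type.
HB.instance Definition _ := EqQuotient.on quo_type.

Definition quo_pi (x : V) : quo_type := \pi_quo_type x.

Lemma quo_piW (P : quo_type -> Prop) : (forall x, P (quo_pi x)) -> forall z, P z.
Proof. by move=> Ppi; elim/quotW. Qed.

Lemma quo_eqP x y : quo_pi x = quo_pi y <-> S (x - y).
Proof.
split=> [/eqmodP/asboolP//|Sxy].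
exact/eqmodP/asboolP.
Qed.

Definition quo_add (x y : quo_type) : quo_type := quo_pi (repr x + repr y).
Definition quo_opp (x : quo_type) : quo_type := quo_pi (- repr x).
Definition quo_scale (a : rat) (x : quo_type) : quo_type := quo_pi (a *: repr x).

Lemma quo_repr x : S (repr (quo_pi x) - x).
Proof. by apply/quo_eqP; rewrite /quo_pi reprK. Qed.

Lemma quo_addE x y : quo_add (quo_pi x) (quo_pi y) = quo_pi (x + y).
Proof.
by apply/quo_eqP; rewrite opprD addrACA; apply: smemD; exact: quo_repr.
Qed.
Lemma quo_oppE x : quo_opp (quo_pi x) = quo_pi (- x).
Proof. by apply/quo_eqP; rewrite -opprD; apply/smemN/quo_repr. Qed.
Lemma quo_scaleE a x : quo_scale a (quo_pi x) = quo_pi (a *: x).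
Proof. by apply/quo_eqP; rewrite -scalerBr; apply/smemZ/quo_repr. Qed.

Lemma quo_addA : associative quo_add.
Proof.
elim/quo_piW=> x; elim/quo_piW=> y; elim/quo_piW=> z.
by rewrite !quo_addE addrA.
Qed.
Lemma quo_addC : commutative quo_add.
Proof. by elim/quo_piW=> x; elim/quo_piW=> y; rewrite !quo_addE addrC. Qed.
Lemma quo_add0 : left_id (quo_pi 0) quo_add.
Proof. by elim/quo_piW=> x; rewrite quo_addE add0r. Qed.
Lemma quo_addN : left_inverse (quo_pi 0) quo_opp quo_add.
Proof. by elim/quo_piW=> x; rewrite quo_oppE quo_addE addNr. Qed.
HB.instance Definition _ := GRing.isZmodule.Build quo_type
  quo_addA quo_addC quo_add0 quo_addN.

Lemma quo_scaleA a b x : quo_scale a (quo_scale b x) = quo_scale (a * b) x.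
Proof. by elim/quo_piW: x => x; rewrite !quo_scaleE scalerA. Qed.
Lemma quo_scale1 : left_id 1 quo_scale.
Proof. by elim/quo_piW=> x; rewrite quo_scaleE scale1r. Qed.
Lemma quo_scaleDr : right_distributive quo_scale quo_add.
Proof.
move=> a; elim/quo_piW=> x; elim/quo_piW=> y.
by rewrite !(quo_scaleE, quo_addE) scalerDr.
Qed.
Lemma quo_scaleDl x a b : quo_scale (a + b) x = quo_add (quo_scale a x) (quo_scale b x).
Proof.
by elim/quo_piW: x => x; rewrite !(quo_scaleE, quo_addE) scalerDl.
Qed.
HB.instance Definition _ := GRing.Zmodule_isLmodule.Build rat quo_type
  quo_scaleA quo_scale1 quo_scaleDr quo_scaleDl.

Definition quo : vect := quo_type.

Lemma quo_pi_linear : linear (quo_pi : V -> quo).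
Proof.
by move=> a x y; rewrite -quo_addE -quo_scaleE.
Qed.
End Quo.

HB.lock Definition qpi (V : vect) (S : subspace V) : {linear V -> quo S} :=
  lin (@quo_pi_linear V S).

Section QuoPi.
Variables (V : vect) (S : subspace V).
Local Notation qpi := (qpi S).

Lemma qpi_eq x y : qpi x = qpi y <-> S (x - y).
Proof. by rewrite qpi.unlock; exact: quo_eqP. Qed.

Lemma qpi_eq0 x : qpi x = 0 <-> S x.
Proof. by rewrite -[0](linear0 qpi) qpi_eq subr0. Qed.

Lemma qpi_surj (z : quo S) : exists x, z = qpi x.
Proof. by rewrite qpi.unlock; elim/quo_piW: z => x; exists x. Qed.

Section Lift.
Variables (W : vect) (f : {linear V -> W}).
Hypothesis fS : forall x, S x -> f x = 0.

Definition qlift_fun (z : quo S) : W := f (repr (z : quo_type S)).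

Lemma qlift_funE x : qlift_fun (qpi x) = f x.
Proof.
rewrite qpi.unlock; apply/eqP; rewrite -subr_eq0 -linearB.
exact/eqP/fS/quo_repr.
Qed.

Lemma qlift_linear : linear qlift_fun.
Proof.
move=> a x y; have [x' ->] := qpi_surj x; have [y' ->] := qpi_surj y.
by rewrite -linearP !qlift_funE linearP.
Qed.
End Lift.
End QuoPi.

HB.lock Definition qlift (V : vect) (S : subspace V) (W : vect)
    (f : {linear V -> W}) (fS : forall x, S x -> f x = 0) :
    {linear quo S -> W} :=
  lin (qlift_linear fS).

Lemma qliftE (V : vect) (S : subspace V) (W : vect)
    (f : {linear V -> W}) (fS : forall x, S x -> f x = 0) x :
  qlift fS (qpi S x) = f x.
Proof. by rewrite qlift.unlock; exact: qlift_funE. Qed.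

Section Dprod.
Variables (I : Type) (V : I -> vect).

Definition dprod_type := forall i, V i.
HB.instance Definition _ := Choice.on dprod_type.

Definition dprod_add (x y : dprod_type) : dprod_type := fun i => x i + y i.
Definition dprod_opp (x : dprod_type) : dprod_type := fun i => - x i.
Definition dprod_scale (a : rat) (x : dprod_type) : dprod_type :=
  fun i => a *: x i.

Lemma dprod_addA : associative dprod_add.
Proof. by move=> x y z; apply: fext => i; exact: addrA. Qed.
Lemma dprod_addC : commutative dprod_add.
Proof. by move=> x y; apply: fext => i; exact: addrC. Qed.
Lemma dprod_add0 : left_id (fun=> 0) dprod_add.
Proof. by move=> x; apply: fext => i; exact: add0r. Qed.
Lemma dprod_addN : left_inverse (fun=> 0) dprod_opp dprod_add.
Proof. by move=> x; apply: fext => i; exact: addNr. Qed.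
HB.instance Definition _ := GRing.isZmodule.Build dprod_type
  dprod_addA dprod_addC dprod_add0 dprod_addN.

Lemma dprod_scaleA a b x :
  dprod_scale a (dprod_scale b x) = dprod_scale (a * b) x.
Proof. by apply: fext => i; exact: scalerA. Qed.
Lemma dprod_scale1 : left_id 1 dprod_scale.
Proof. by move=> x; apply: fext => i; exact: scale1r. Qed.
Lemma dprod_scaleDr : right_distributive dprod_scale +%R.
Proof. by move=> a x y; apply: fext => i; exact: scalerDr. Qed.
Lemma dprod_scaleDl x : {morph dprod_scale^~ x : a b / a + b}.
Proof. by move=> a b; apply: fext => i; exact: scalerDl. Qed.
HB.instance Definition _ := GRing.Zmodule_isLmodule.Build rat dprod_type
  dprod_scaleA dprod_scale1 dprod_scaleDr dprod_scaleDl.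

Definition dprod : vect := dprod_type.

Lemma dprodP (x y : dprod) : (forall i, x i = y i) -> x = y.
Proof. exact: fext. Qed.

Lemma dprodE a (x y : dprod) i : (a *: x + y) i = a *: x i + y i.
Proof. by []. Qed.

Lemma dprod0E i : (0 : dprod) i = 0. Proof. by []. Qed.
End Dprod.

Section Tensor.
Variables (I : eqType) (V : I -> vect).

Definition multilinear (W : vect) (f : (forall i, V i) -> W) :=
  forall v i (a : rat) (x y : V i),
    f (dfwith v (a *: x + y)) = a *: f (dfwith v x) + f (dfwith v y).

Notation free := {malg rat[(forall i, V i)]}.

Definition free_gen (v : forall i, V i) : free := mkmalgU v 1.

Inductive tensor_rel : free -> Prop :=
| TensorRel v i (a : rat) (x y : V i) :
    tensor_rel (free_gen (dfwith v (a *: x + y))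
                - (a *: free_gen (dfwith v x) + free_gen (dfwith v y))).

(* The subspace spanned by the multilinearity relations. *)
Definition tensor_rels : subspace free.
exists (fun z => forall S : subspace free, (forall r, tensor_rel r -> S r) -> S z).
- by move=> S _; exact: smem0.
- by move=> a x y xP yP S SP; apply: smemP; [exact: xP|exact: yP].
Defined.

Definition tensor : vect := quo tensor_rels.

Definition pure (v : forall i, V i) : tensor := qpi tensor_rels (free_gen v).

Lemma pure_multilinear : multilinear pure.
Proof.
move=> v i a x y; rewrite /pure -linearP; apply/qpi_eq => S; apply.
exact: TensorRel.
Qed.

Lemma free_ind (S : subspace free) : (forall v, S (free_gen v)) -> forall z, S z.
Proof.
move=> Sg z; rewrite [z]monalgE; apply: (big_ind (smem S)).
- exact: smem0.
- exact: smemD.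
- move=> v _; have -> : (mkmalgU v z@_v : free) = z@_v *: free_gen v.
    apply/malgP=> w; rewrite malgZ_def fgscaleE !mcoeffU.
    by case: eqP; rewrite ?mulr1n ?mulr0n ?mulr1 ?mulr0.
  exact/smemZ/Sg.
Qed.

Section Universal.
Variables (W : vect) (f : (forall i, V i) -> W).

Definition free_lift_fun (z : free) : W := \sum_(v <- msupp z) z@_v *: f v.

Lemma free_liftw (z : free) (d : {fset (forall i, V i)}%fset) :
  (msupp z `<=` d)%fset -> free_lift_fun z = \sum_(v <- d) z@_v *: f v.
Proof.
move=> zd; rewrite /free_lift_fun (big_fset_incl _ zd) // => v _ vz.
by rewrite mcoeff_outdom // scale0r.
Qed.

Lemma free_lift_linear : linear free_lift_fun.
Proof.
move=> a x y; pose d := (msupp x `|` msupp y)%fset.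
have xd : (msupp x `<=` d)%fset by exact: fsubsetUl.
have yd : (msupp y `<=` d)%fset by exact: fsubsetUr.
rewrite (free_liftw xd) (free_liftw yd) (@free_liftw _ d); last first.
  apply: (fsubset_trans (msuppD_le _ _)); rewrite fsubUset yd andbT.
  exact: (fsubset_trans (msuppZ_le _ _) xd).
rewrite scaler_sumr -big_split; apply: eq_bigr => v _ /=.
by rewrite mcoeffD malgZ_def fgscaleE scalerDl scalerA.
Qed.
Definition free_lift : {linear free -> W} := lin free_lift_linear.

Lemma free_liftE v : free_lift (free_gen v) = f v.
Proof.
rewrite /free_lift /= (@free_liftw _ [fset v]%fset) ?msuppU_le //.
by rewrite big_seq_fset1 mcoeffU eqxx scale1r.
Qed.

Hypothesis fM : multilinear f.

Lemma free_lift_rels z : tensor_rels z -> free_lift z = 0.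
Proof.
have SP : forall (a : rat) x y, free_lift x = 0 -> free_lift y = 0 ->
    free_lift (a *: x + y) = 0.
  by move=> a x y x0 y0; rewrite linearP x0 y0 scaler0 addr0.
move/(_ (Subspace (linear0 free_lift) SP)); apply => _ [v i a x y].
change (free_lift (free_gen (dfwith v (a *: x + y))
  - (a *: free_gen (dfwith v x) + free_gen (dfwith v y))) = 0).
by rewrite linearB linearP !free_liftE fM subrr.
Qed.

Definition tensor_lift : {linear tensor -> W} := qlift free_lift_rels.

Lemma tensor_liftE v : tensor_lift (pure v) = f v.
Proof. by rewrite /tensor_lift qliftE free_liftE. Qed.
End Universal.

Lemma tensor_ext (W : vect) (f g : {linear tensor -> W}) :
  (forall v, f (pure v) = g (pure v)) -> f =1 g.
Proof.
move=> fg z; have [x ->] := qpi_surj z.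
have SP : forall (a : rat) x y, f (qpi _ x) = g (qpi _ x) ->
    f (qpi _ y) = g (qpi _ y) -> f (qpi _ (a *: x + y)) = g (qpi tensor_rels (a *: x + y)).
  by move=> a x' y xP yP; rewrite !linearP xP yP.
have S0 : f (qpi tensor_rels 0) = g (qpi tensor_rels 0) by rewrite !linear0.
exact: (@free_ind (Subspace S0 SP)).
Qed.
End Tensor.

Section TensorMap.
Variables (I : eqType).

Lemma pure_map_multilinear (V W : I -> vect)
    (f : forall i, {linear V i -> W i}) :
  multilinear (fun v => pure (fun i => f i (v i))).
Proof.
move=> v i a x y.
have E z : (fun j => f j (dfwith v z j)) = dfwith (fun j => f j (v j)) (f i z).
  apply: fext => j.
  by case: dfwithP => [|j' ij]; rewrite ?dfwith_in ?dfwith_out.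
by rewrite !E linearP pure_multilinear.
Qed.

End TensorMap.

HB.lock Definition tmap (I : eqType) (V W : I -> vect)
    (f : forall i, {linear V i -> W i}) : {linear tensor V -> tensor W} :=
  tensor_lift (pure_map_multilinear f).

Section TensorMapTheory.
Variables (I : eqType).

Lemma tmapE (V W : I -> vect) (f : forall i, {linear V i -> W i}) v :
  tmap f (pure v) = pure (fun i => f i (v i)).
Proof. by rewrite tmap.unlock; exact: tensor_liftE. Qed.

Lemma tmap_eq (V W : I -> vect) (f g : forall i, {linear V i -> W i}) :
  (forall i, f i =1 g i) -> tmap f =1 tmap g.
Proof.
move=> fg; apply: tensor_ext => v; rewrite !tmapE; congr pure.
by apply: fext => i; exact: fg.
Qed.

Lemma tmap_id (V : I -> vect) (f : forall i, {linear V i -> V i}) :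
  (forall i, f i =1 id) -> tmap f =1 id.
Proof.
move=> fid; apply: (@tensor_ext _ _ _ (tmap f) idfun) => v.
apply: (etrans (tmapE _ _)); rewrite -[RHS]/(pure v).
by congr pure; apply: fext => i; exact: fid.
Qed.

Lemma tmap_comp (U V W : I -> vect) (g : forall i, {linear V i -> W i})
    (f : forall i, {linear U i -> V i}) (h : forall i, {linear U i -> W i}) :
  (forall i, h i =1 g i \o f i) -> forall x, tmap g (tmap f x) = tmap h x.
Proof.
move=> hE; apply: (@tensor_ext _ _ _ (tmap g \o tmap f) (tmap h)) => v.
rewrite -[LHS]/(tmap g (tmap f (pure v))) !tmapE; congr pure.
by apply: fext => i; rewrite hE.
Qed.

Lemma pure_eq0 (V : I -> vect) (v : forall i, V i) i :
  v i = 0 -> pure v = 0.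
Proof.
move=> vi0; have E : v = dfwith v (0 : V i).
  by apply: fext => j; case: dfwithP => // ; rewrite vi0.
have := pure_multilinear v (-1) (0 : V i) 0.
by rewrite scaler0 addr0 -E scaleN1r addNr.
Qed.

Lemma tmap0 (V W : I -> vect) (f : forall i, {linear V i -> W i}) i :
  (forall x, f i x = 0) -> forall x, tmap f x = 0.
Proof.
move=> fi0; apply: (@tensor_ext _ _ _ (tmap f) \0) => v.
by apply: (etrans (tmapE _ _)); exact: (@pure_eq0 _ _ i).
Qed.
End TensorMapTheory.

Record cochain := Cochain {
  cdeg :> nat -> vect;
  cdiff : forall k, {linear cdeg k -> cdeg k.+1};
  cdiffK : forall k x, cdiff k.+1 (cdiff k x) = 0 }.
Arguments cdiff {c} k.

Record cmap (A B : cochain) := Cmap {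
  cmap_fun :> forall k, {linear A k -> B k};
  cmapP : forall k x, cmap_fun k.+1 (cdiff k x) = cdiff k (cmap_fun k x) }.

(* The differential ending in degree k, whose source is 0 when k = 0. *)
Definition cdiff_to (A : cochain) k : {linear A k.-1 -> A k} :=
  match k with 0%N => \0 | k'.+1 => cdiff k' end.

Lemma cdiff_toK (A : cochain) k x : cdiff_to A k (cdiff_to A k.-1 x) = 0.
Proof. by case: k x => [|[|k]] x //=; rewrite ?linear0 // cdiffK. Qed.

Definition cmap_id (A : cochain) : cmap A A :=
  @Cmap A A (fun k => idfun) (fun k x => erefl).

Section ZeroComplex.
Definition zero_cochain : cochain.
by exists (fun=> 'rV[rat]_0) (fun=> \0).
Defined.

Definition zero_cmap (A B : cochain) : cmap A B.
by exists (fun=> \0) => k x; rewrite /= linear0.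
Defined.
End ZeroComplex.

Section SubComplex.
Variables (A : cochain) (S : forall k, subspace (A k)).
Hypothesis dS : forall k x, S k x -> S k.+1 (cdiff k x).

Definition subcomplex : cochain.
exists (fun k => sub (S k)) (fun k => sub_map (@dS k)).
by move=> k x; apply: val_inj; rewrite /= cdiffK.
Defined.
End SubComplex.

Section ProdComplex.
Variables (I : Type) (A : I -> cochain).

Lemma prod_diff_linear k :
  linear (fun (x : dprod (fun i => A i k)) => (fun i => cdiff k (x i)) : dprod _).
Proof. by move=> a x y; apply: dprodP => i; rewrite !dprodE linearP. Qed.

Definition prod_cochain : cochain.
exists (fun k => dprod (fun i => A i k)) (fun k => lin (@prod_diff_linear k)).
by move=> k x; apply: dprodP => i; rewrite /= cdiffK.
Defined.
End ProdComplex.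

Section Cohomology.

Section Complex.
Variable A : cochain.

Definition cocycles k : subspace (A k).
exists (fun x => cdiff k x = 0); first exact: linear0.
by move=> a x y x0 y0; rewrite linearP x0 y0 scaler0 addr0.
Defined.

Definition coboundaries k : subspace (sub (cocycles k)).
exists (fun z : sub (cocycles k) => exists y, cdiff_to A k y = val z).
  by exists 0; rewrite !linear0.
by move=> a x y [x' xE] [y' yE]; exists (a *: x' + y'); rewrite !linearP xE yE.
Defined.

Definition coh k : vect := quo (coboundaries k).

Definition coh_cochain : cochain := @Cochain coh (fun k => \0) (fun k x => erefl).
End Complex.

Variables (A B : cochain) (f : cmap A B).

Lemma cmap_cocycle k x : cocycles A k x -> cocycles B k (f k x).
Proof. by move=> /= x0; rewrite -cmapP x0 linear0. Qed.

Definition coh_map_fun k : {linear sub (cocycles A k) -> coh B k} :=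
  qpi (coboundaries B k) \o sub_map (@cmap_cocycle k).

Lemma coh_map_fun0 k z : coboundaries A k z -> coh_map_fun k z = 0.
Proof.
case=> y yz; apply/qpi_eq0; exists (f k.-1 y); rewrite /= -yz.
by case: k y z yz => [|k] y z yz /=; rewrite ?linear0 // cmapP.
Qed.

Definition coh_map k : {linear coh A k -> coh B k} := qlift (@coh_map_fun0 k).

Lemma coh_mapE k z :
  coh_map k (qpi _ z) = qpi _ (sub_map (@cmap_cocycle k) z).
Proof. exact: qliftE. Qed.

Definition coh_cmap : cmap (coh_cochain A) (coh_cochain B).
by exists coh_map => k x; exact: linear0.
Defined.
End Cohomology.

Section TensorComplex.
Variables (m : nat) (C : 'I_m -> cochain).

(* Elements are families indexed by multidegrees; the part of total degree k
   consists of the families concentrated in the multidegrees of sum k. *)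
Definition tensor_all : vect :=
  dprod (fun e : 'I_m -> nat => tensor (fun i => C i (e i))).

Definition tensor_deg (k : nat) : subspace tensor_all.
exists (fun w : tensor_all => forall e : 'I_m -> nat, (\sum_i e i)%N != k -> w e = 0) => //.
by move=> a x y x0 y0 e ek; rewrite dprodE x0 // y0 // scaler0 addr0.
Defined.

Definition lower (i : 'I_m) (e : 'I_m -> nat) : 'I_m -> nat :=
  fun j => if j == i then (e j).-1 else e j.

Definition diff_or_id (A : cochain) (b : bool) k :
    {linear A (if b then k.-1 else k) -> A k} :=
  if b return {linear A (if b then k.-1 else k) -> A k} then cdiff_to A k
  else idfun.

(* The map 1 (x) d (x) 1 with d in position i, into multidegree e; it is 0 when
   e i = 0. *)
Definition diff_at (i : 'I_m) (e : 'I_m -> nat) :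
    {linear tensor (fun j => C j (lower i e j)) -> tensor (fun j => C j (e j))} :=
  tmap (fun j => diff_or_id (C j) (j == i) (e j)).

Definition koszul (i : 'I_m) (e : 'I_m -> nat) : rat :=
  (-1) ^+ (\sum_(j < m | (j < i)%N) e j)%N.

Definition tensor_diff_fun (w : tensor_all) : tensor_all :=
  fun e => \sum_i koszul i e *: diff_at i e (w (lower i e)).

Lemma tensor_diff_linear : linear tensor_diff_fun.
Proof.
move=> a x y; apply: dprodP => e; rewrite dprodE /tensor_diff_fun.
rewrite scaler_sumr -big_split; apply: eq_bigr => i _ /=.
by rewrite dprodE linearP scalerDr !scalerA mulrC.
Qed.

Definition tensor_diff : {linear tensor_all -> tensor_all} :=
  lin tensor_diff_linear.

Lemma diff_at0 i e x : e i = 0%N -> diff_at i e x = 0.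
Proof.
move=> ei; apply: (@tmap0 _ _ _ _ i) => {}x.
by move: x; rewrite /lower eqxx ei.
Qed.

Lemma sum_lower i e : e i != 0%N -> ((\sum_j lower i e j).+1 = \sum_j e j)%N.
Proof.
move=> ei; rewrite (bigD1 i) // [RHS](bigD1 i) //= /lower eqxx -addSn.
rewrite prednK ?lt0n //; congr (_ + _)%N.
by apply: eq_bigr => j /negPf ->.
Qed.

Lemma tensor_diff_deg k w : tensor_deg k w -> tensor_deg k.+1 (tensor_diff w).
Proof.
move=> wk e ek; rewrite /= /tensor_diff_fun big1 // => i _.
have [/diff_at0 -> //|ei] := eqVneq (e i) 0%N; first by rewrite scaler0.
rewrite wk ?linear0 ?scaler0 //.
by apply: contra ek => /eqP <-; rewrite sum_lower.
Qed.

Lemma lowerC i h e : lower h (lower i e) = lower i (lower h e).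
Proof. by apply: funext => j; rewrite /lower; case: eqP; case: eqP. Qed.

Lemma tmap_transport (w : tensor_all) (e1 e2 e : 'I_m -> nat)
    (f1 : forall j, {linear C j (e1 j) -> C j (e j)})
    (f2 : forall j, {linear C j (e2 j) -> C j (e j)})
    (E : e1 = e2) :
  (forall j (Ej : e1 j = e2 j) x,
     f1 j x = f2 j (eq_rect _ (fun k => C j k) x _ Ej)) ->
  tmap f1 (w e1) = tmap f2 (w e2).
Proof.
subst e2 => fE; apply: tmap_eq => j x.
exact: (fE j erefl).
Qed.

Lemma diff_or_idC (A : cochain) b c k
    (E : (if c then (if b then k.-1 else k).-1 else (if b then k.-1 else k))
       = (if b then (if c then k.-1 else k).-1 else (if c then k.-1 else k))) x :
  ~~ (b && c) ->
  diff_or_id A b k (diff_or_id A c _ x) =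
  diff_or_id A c k (diff_or_id A b _ (eq_rect _ (fun k => A k) x _ E)).
Proof. by case: b c E x => [] [] // E x; rewrite (eq_irrelevance E erefl). Qed.

Lemma diff_at_comp (w : tensor_all) i h e :
  diff_at i e (diff_at h (lower i e) (w (lower h (lower i e)))) =
  tmap (fun j => diff_or_id (C j) (j == i) (e j) \o
                 diff_or_id (C j) (j == h) (lower i e j))
       (w (lower h (lower i e))).
Proof. exact: tmap_comp. Qed.

Lemma diff_atC (w : tensor_all) i h e : i != h ->
  diff_at i e (diff_at h (lower i e) (w (lower h (lower i e)))) =
  diff_at h e (diff_at i (lower h e) (w (lower i (lower h e)))).
Proof.
move=> ih; rewrite !diff_at_comp; apply: tmap_transport; first exact: lowerC.
move=> j E x; apply: diff_or_idC.
by apply/negP => /andP[/eqP ji /eqP jh]; rewrite -ji -jh eqxx in ih.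
Qed.

Lemma diff_at_self (w : tensor_all) i e :
  diff_at i e (diff_at i (lower i e) (w (lower i (lower i e)))) = 0.
Proof.
rewrite diff_at_comp; apply: (@tmap0 _ _ _ _ i) => x /=.
by move: x; rewrite /lower eqxx /= => x; exact: cdiff_toK.
Qed.

Lemma koszul_lower (i h : 'I_m) (e : 'I_m -> nat) : e i != 0%N -> (i < h)%N ->
  koszul i e * koszul h (lower i e) + koszul h e * koszul i (lower h e) = 0.
Proof.
move=> ei ih; have -> : koszul i (lower h e) = koszul i e.
  congr (_ ^+ _); apply: eq_bigr => j ji; rewrite /lower ifN //.
  by apply/eqP => jh; rewrite jh ltnNge (ltnW ih) in ji.
rewrite (mulrC (koszul h e)) -mulrDr; apply/eqP; rewrite mulf_eq0; apply/orP; right.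
have -> : koszul h e = - koszul h (lower i e).
  rewrite /koszul -[- (_ ^+ _)]mulN1r -exprS; congr (_ ^+ _).
  rewrite (bigD1 i) //= [in RHS](bigD1 i) //= /lower eqxx -addSn.
  rewrite prednK ?lt0n //; congr (_ + _)%N.
  by apply: eq_bigr => j /andP[_ /negPf ->].
by rewrite subrr.
Qed.

Lemma tensor_diffK (w : tensor_all) : tensor_diff (tensor_diff w) = 0.
Proof.
apply: dprodP => e; rewrite dprod0E /= /tensor_diff_fun.
pose D i h := diff_at i e (diff_at h (lower i e) (w (lower h (lower i e)))).
pose G i h := (koszul i e * koszul h (lower i e)) *: D i h.
have -> : \sum_i koszul i e *: diff_at i e
    (\sum_h koszul h (lower i e) *: diff_at h (lower i e) (w (lower h (lower i e))))
    = \sum_i \sum_h G i h.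
  apply: eq_bigr => i _; rewrite linear_sum scaler_sumr.
  by apply: eq_bigr => h _; rewrite linearZ scalerA.
have GC (i h : 'I_m) : (i < h)%N -> G i h + G h i = 0.
  move=> ih; have ihn : i != h by rewrite neq_ltn ih.
  rewrite /G /D diff_atC //; have [e0|e0] := eqVneq (e i) 0%N.
    by rewrite -diff_atC // !(diff_at0 _ e0) !scaler0 addr0.
  by rewrite -scalerDl koszul_lower // scale0r.
have Gii i : G i i = 0 by rewrite /G /D diff_at_self scaler0.
have -> : \sum_i \sum_h G i h =
    \sum_(i < m) \sum_(h < m | (i < h)%N) (G i h + G h i).
  under eq_bigr => i _ do
    rewrite (bigID (fun h : 'I_m => (i < h)%N)) /=.
  rewrite big_split /=; under [RHS]eq_bigr => i _ do rewrite big_split /=.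
  rewrite [RHS]big_split /=; congr (_ + _).
  rewrite [RHS](exchange_big_dep predT) //=; apply: eq_bigr => i _.
  rewrite (bigID (fun h : 'I_m => h == i)) /= (big_pred1 i) => [|h]; last first.
    by apply: andb_idl => /eqP ->; rewrite ltnn.
  rewrite Gii add0r; apply: eq_bigl => h.
  by rewrite -leqNgt ltn_neqAle andbC.
by rewrite big1 // => i _; rewrite big1 // => h; exact: GC.
Qed.

Definition tensor_cochain : cochain.
exists (fun k => sub (tensor_deg k)) (fun k => sub_map (@tensor_diff_deg k)).
by move=> k x; apply: val_inj; exact: tensor_diffK.
Defined.
End TensorComplex.

Section TensorCmap.
Variables (m : nat).

Section Map.
Variables (C D : 'I_m -> cochain) (f : forall i, cmap (C i) (D i)).

Definition tensor_all_map_fun (w : tensor_all C) : tensor_all D :=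
  fun e => tmap (fun i => f i (e i)) (w e).

Lemma tensor_all_map_linear : linear tensor_all_map_fun.
Proof. by move=> a x y; apply: dprodP => e; rewrite dprodE -linearP. Qed.

Definition tensor_all_map : {linear tensor_all C -> tensor_all D} :=
  lin tensor_all_map_linear.

Lemma tensor_all_map_deg k w :
  tensor_deg C k w -> tensor_deg D k (tensor_all_map w).
Proof. by move=> wk e ek; rewrite /= /tensor_all_map_fun wk // linear0. Qed.

Definition tensor_cmap : cmap (tensor_cochain C) (tensor_cochain D).
exists (fun k => sub_map (@tensor_all_map_deg k)) => k x.
apply: val_inj; apply: dprodP => e /=.
rewrite /tensor_all_map_fun /tensor_diff_fun linear_sum; apply: eq_bigr => i _.
rewrite linearZ; congr (_ *: _).
pose g j : {linear C j (lower i e j) -> D j (e j)} :=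
  f j (e j) \o diff_or_id (C j) (j == i) (e j).
rewrite (@tmap_comp _ _ _ _ _ _ g) // (@tmap_comp _ _ _ _ _ _ g) // => j y /=.
move: y; rewrite /g /lower /=; case: (j == i) => //=.
by case: (e j) => [|l] y /=; rewrite ?linear0 // cmapP.
Defined.

Lemma tensor_cmapE k (x : tensor_cochain C k) e :
  val (tensor_cmap k x) e = tmap (fun i => f i (e i)) (val x e).
Proof. by []. Qed.
End Map.
End TensorCmap.

(* Injective order-preserving maps {0 < ... < a-1} -> {0 < ... < b-1}.  The
   simplex Delta^j is represented by its number j + 1 of vertices, so that
   a = 0 encodes the empty simplex Delta^{-1}. *)
Record face (a b : nat) := Face {
  face_fun :> {ffun 'I_a -> 'I_b};
  faceP : injectiveb face_fun
          && [forall x : 'I_a, forall y : 'I_a, (x <= y)%N ==> (face_fun x <= face_fun y)%N] }.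

Lemma face_inj a b (f : face a b) : injective f.
Proof. by case/andP: (faceP f) => /injectiveP. Qed.

Lemma face_le a b (f : face a b) (x y : 'I_a) : (x <= y)%N -> (f x <= f y)%N.
Proof. by case/andP: (faceP f) => _ /forallP/(_ x)/forallP/(_ y)/implyP. Qed.

Lemma face_intro a b (f : 'I_a -> 'I_b) :
  injective f -> (forall x y : 'I_a, (x <= y)%N -> (f x <= f y)%N) ->
  injectiveb (finfun f)
  && [forall x : 'I_a, forall y : 'I_a, (x <= y)%N ==> (finfun f x <= finfun f y)%N].
Proof.
move=> fI f_le; apply/andP; split.
  by apply/injectiveP => x y; rewrite !ffunE => /fI.
apply/forallP => x; apply/forallP => y; apply/implyP => xy.
by rewrite !ffunE f_le.
Qed.

Definition face_of a b (f : 'I_a -> 'I_b) fI f_le : face a b :=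
  Face (@face_intro a b f fI f_le).

Definition face_id a : face a a := face_of (@inj_id 'I_a) (fun x y xy => xy).

Definition face_comp a b c (g : face b c) (f : face a b) : face a c :=
  face_of (inj_comp (@face_inj _ _ g) (@face_inj _ _ f))
    (fun x y xy => face_le g (face_le f xy)).

Lemma lift_max_le a (x y : 'I_a) :
  (x <= y)%N -> (lift ord_max x <= lift ord_max y)%N.
Proof. by rewrite !lift_max. Qed.

(* The face of the cone on Delta^{a-1} opposite to the cone point, which is
   the last vertex. *)
Definition face_base a : face a a.+1 :=
  face_of (@lift_inj _ ord_max) (@lift_max_le a).

Definition cone_fun a b (f : 'I_a -> 'I_b) (x : 'I_a.+1) : 'I_b.+1 :=
  if unlift ord_max x is Some y then lift ord_max (f y) else ord_max.

Lemma cone_fun_inj a b (f : face a b) : injective (cone_fun f).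
Proof.
move=> x y; rewrite /cone_fun.
case: unliftP => [x'|] ->; case: unliftP => [y'|] -> //.
- by move/lift_inj/face_inj ->.
- by move/eqP; rewrite eq_sym (negPf (neq_lift _ _)).
- by move/eqP; rewrite (negPf (neq_lift _ _)).
Qed.

Lemma cone_fun_le a b (f : face a b) (x y : 'I_a.+1) :
  (x <= y)%N -> (cone_fun f x <= cone_fun f y)%N.
Proof.
rewrite /cone_fun; case: (unliftP ord_max y) => [y'|] ->; last by move=> _; exact: leq_ord.
case: unliftP => [x'|] ->; last by rewrite lift_max leqNgt ltn_ord.
by rewrite !lift_max; exact: face_le.
Qed.

Definition face_cone a b (f : face a b) : face a.+1 b.+1 :=
  face_of (@cone_fun_inj a b f) (@cone_fun_le a b f).

(* The join of simplices with v i vertices in the factor of index i. *)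
Record join_obj (n : nat) := JoinObj {
  verts :> 'I_n.+1 -> nat;
  join_nonempty : [exists i, (0 < verts i)%N] }.

Definition join_mor n (v w : join_obj n) := forall i, face (v i) (w i).

Record filtered_face_set (n : nat) := FilteredFaceSet {
  simplices :> join_obj n -> Type;
  pull : forall v w, join_mor v w -> simplices w -> simplices v;
  pull_id : forall v (s : simplices v), pull (fun i => face_id (v i)) s = s;
  pull_comp : forall u v w (g : join_mor v w) (f : join_mor u v) s,
    pull (fun i => face_comp (g i) (f i)) s = pull f (pull g s) }.

(* sys m is the value at [m] = {0, ..., m}, which has m + 1 elements. *)
Record universal_system := UniversalSystem {
  sys : nat -> cochain;
  sys_map : forall a b, face a.+1 b.+1 -> cmap (sys b) (sys a);
  sys_map_id : forall a k x, sys_map (face_id a.+1) k x = x;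
  sys_map_comp : forall a b c (g : face b.+1 c.+1) (f : face a.+1 b.+1) k x,
    sys_map (face_comp g f) k x = sys_map f k (sys_map g k x) }.

(* The system as a function of the number of vertices.  The value at the empty
   simplex is a dummy: it never occurs in the factors of a blow-up. *)
Definition sysv (F : universal_system) (a : nat) : cochain :=
  if a is a'.+1 then sys F a' else zero_cochain.

Definition sysv_map (F : universal_system) (a b : nat) :
    face a b -> cmap (sysv F b) (sysv F a) :=
  match a, b return face a b -> cmap (sysv F b) (sysv F a) with
  | a'.+1, b'.+1 => fun f => sys_map F f
  | _, _ => fun _ => zero_cmap _ _
  end.

Section Blowup.
Variable F : universal_system.

Definition sys_tensor m (a : 'I_m -> nat) : cochain :=
  tensor_cochain (fun i => sysv F (a i)).

Definition sys_tensor_map m (a b : 'I_m -> nat) (f : forall i, face (a i) (b i)) :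
    cmap (sys_tensor b) (sys_tensor a) :=
  tensor_cmap (fun i => sysv_map F (f i)).

Variables (n : nat) (K : filtered_face_set n).

(* Numbers of vertices of c Delta^{j_0}, ..., c Delta^{j_(n-1)}, Delta^{j_n}. *)
Definition blow_verts (v : 'I_n.+1 -> nat) (i : 'I_n.+1) : nat :=
  ((i != ord_max) + v i)%N.

Definition cone_if (b : bool) a a' (f : face a a') : face (b + a) (b + a') :=
  if b return face (b + a) (b + a') then face_cone f else f.

Definition blow_map (v w : join_obj n) (f : join_mor v w) :
    cmap (sys_tensor (blow_verts w)) (sys_tensor (blow_verts v)) :=
  sys_tensor_map (fun i => cone_if (i != ord_max) (f i)).

Record simplex_plus := SimplexPlus {
  sp_obj : join_obj n;
  sp_plus : (0 < sp_obj ord_max)%N;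
  sp_simplex : K sp_obj }.

Definition all_families : cochain :=
  prod_cochain (fun s : simplex_plus => sys_tensor (blow_verts (sp_obj s))).

Definition compatible (k : nat) : subspace (all_families k).
exists (fun w : all_families k => forall (u v : join_obj n) (u0 : (0 < u ord_max)%N)
    (v0 : (0 < v ord_max)%N) (f : join_mor u v) (s : K v),
  w (SimplexPlus u0 (pull f s)) = blow_map f k (w (SimplexPlus v0 s))).
- by move=> *; rewrite !dprod0E linear0.
- by move=> a x y xC yC *; rewrite !dprodE linearP -xC -yC.
Defined.

Lemma compatible_diff k w : compatible k w -> compatible k.+1 (cdiff k w).
Proof.
move=> wC u v u0 v0 f s.
change (cdiff k (w (SimplexPlus u0 (pull f s)))
        = blow_map f k.+1 (cdiff k (w (SimplexPlus v0 s)))).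
by rewrite cmapP -wC.
Qed.

Definition blowup : cochain := subcomplex compatible_diff.

(* The last l factors are those of index > n - l, and rev_ord l is n - l. *)
Definition restr_verts (l : 'I_n.+1) (v : 'I_n.+1 -> nat) (i : 'I_n.+1) : nat :=
  (((i != ord_max) && (i != rev_ord l)) + v i)%N.

Definition base_if (b c : bool) a : face ((b && c) + a) (b + a) :=
  match b, c return face ((b && c) + a) (b + a) with
  | true, false => face_base a
  | true, true => face_id a.+1
  | false, _ => face_id a
  end.

Definition restrict (l : 'I_n.+1) (v : 'I_n.+1 -> nat) :
    cmap (sys_tensor (blow_verts v)) (sys_tensor (restr_verts l v)) :=
  sys_tensor_map (fun i => base_if (i != ord_max) (i != rev_ord l) (v i)).

Definition tail_degree (l : 'I_n.+1) (e : 'I_n.+1 -> nat) : nat :=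
  (\sum_(i < n.+1 | (rev_ord l < i)%N) e i)%N.

(* The set is bounded by k, so its supremum is a maximum unless it is empty. *)
Definition local_norm (l : 'I_n.+1) (v : 'I_n.+1 -> nat) k
    (w : sys_tensor (blow_verts v) k) : \bar int :=
  if v (rev_ord l) == 0%N then -oo%E
  else supremum -oo%E
    [set (Posz (tail_degree l e))%:E | e in
      [set e : 'I_n.+1 -> nat | val (restrict l v k w) e <> 0]]%classic.

Definition norm (l : 'I_n.+1) k (w : blowup k) : \bar int :=
  supremum -oo%E [set local_norm l (val w s) | s in [set: simplex_plus]]%classic.

End Blowup.

Lemma int_supremums (A : set (\bar int)) : (supremums A !=set0)%classic.
Proof.
have [Ay|nAy] := pselect (A +oo%E).
  by exists +oo%E; split=> [x _|y /(_ _ Ay)]; rewrite ?leey.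
have [[M AM]|nM] := pselect (exists M : int, ubound A M%:E); last first.
  exists +oo%E; split=> [x _|y Ay]; first exact: leey.
  case: y Ay => [M|//|] Ay; exfalso; apply: nM; first by exists M.
  by exists 0 => x /Ay; rewrite leeNy_eq => /eqP ->; exact: leNye.
have [[r Ar]|nr] := pselect (exists r : int, A r%:E); last first.
  exists -oo%E; split=> [x Ax|y _]; last exact: leNye.
  by case: x Ax => [r|//|//] Ar; case: nr; exists r.
pose P d := `[< A (r + Posz d)%:E >].
have P0 : exists d, P d by exists 0%N; apply/asboolP; rewrite addr0.
have Pb d : P d -> (d <= absz (M - r))%N.
  move=> /asboolP/AM; rewrite lee_fin; lia.
case: (ex_maxnP P0 Pb) => d /asboolP Ad dmax.
exists (r + Posz d)%:E; split=> [x Ax|y]; last exact.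
case: x Ax => [s| |] As //; last exact: leNye.
rewrite lee_fin; have [|rs] := leP s r; first lia.
have : P (absz (s - r)).
  by apply/asboolP; have -> : r + Posz (absz (s - r)) = s by lia.
by move/dmax; lia.
Qed.

Lemma supremum_leP (A : set (\bar int)) b :
  (supremum -oo%E A <= b)%E <-> (forall x, A x -> (x <= b)%E).
Proof.
split=> [Ab x Ax|Ab].
  by apply: le_trans Ab; apply: ge_supremum_Nmem Ax; exact: int_supremums.
rewrite /supremum; case: ifPn => _; first exact: leNye.
have [_] : supremums A (xget -oo%E (supremums A)).
  by have [z zA] := int_supremums A; exact: xgetI zA.
exact.
Qed.

Lemma norm_leP (F : universal_system) n (K : filtered_face_set n) l k
    (w : blowup F K k) (b : \bar int) :
  (norm l w <= b)%E <->
  (forall (s : simplex_plus K) e, (0 < sp_obj s (rev_ord l))%N ->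
     val (restrict F l (sp_obj s) k (val w s)) e <> 0 ->
     ((Posz (tail_degree l e))%:E <= b)%E).
Proof.
rewrite /norm supremum_leP; split=> [H s e s0 we|H x [s _ <-]].
  have /H : [set local_norm l (val w s) | s in [set: simplex_plus K]]%classic
    (local_norm l (val w s)) by exists s.
  by rewrite /local_norm (gtn_eqF s0) supremum_leP; apply; exists e.
rewrite /local_norm; case: eqP => [_|/eqP]; first exact: leNye.
rewrite -lt0n => s0; apply/supremum_leP => _ [e we <-].
exact: H we.
Qed.

Lemma norm0_le (F : universal_system) n (K : filtered_face_set n) l k
    (b : \bar int) :
  (norm l (0 : blowup F K k) <= b)%E.
Proof. by apply/norm_leP => s e _; case; rewrite linear0. Qed.

Lemma norm_lin_le (F : universal_system) n (K : filtered_face_set n) l k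
    (b : \bar int) (a : rat) (x y : blowup F K k) :
  (norm l x <= b)%E -> (norm l y <= b)%E -> (norm l (a *: x + y) <= b)%E.
Proof.
move=> /norm_leP xb /norm_leP yb; apply/norm_leP => s e s0.
have -> : val (restrict F l (sp_obj s) k (val (a *: x + y) s)) e
  = a *: val (restrict F l (sp_obj s) k (val x s)) e
    + val (restrict F l (sp_obj s) k (val y s)) e.
  have -> : val (a *: x + y) s = a *: val x s + val y s by [].
  by rewrite linearP.
have [x0|/eqP x0 _] := eqVneq (val (restrict F l (sp_obj s) k (val x s)) e) 0.
  by rewrite x0 scaler0 add0r; exact: yb.
exact: xb x0.
Qed.

Record gm_perversity (n : nat) := GMPerversity {
  gm_fun :> {ffun 'I_n.+1 -> nat};
  gmP : [forall i : 'I_n.+1, (i <= 2)%N ==> (gm_fun i == 0%N)]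
        && [forall i : 'I_n.+1, forall j : 'I_n.+1,
             (1 <= i)%N && (j == i.+1 :> nat) ==>
               (gm_fun i <= gm_fun j <= (gm_fun i).+1)%N] }.

Inductive perversity (n : nat) := GM of gm_perversity n | Infty.
Arguments Infty {n}.

Section Perversities.
Variable n : nat.
Implicit Types (p q : gm_perversity n) (i j : 'I_n.+1).

Lemma gm_small p i : (i <= 2)%N -> p i = 0%N.
Proof. by case/andP: (gmP p) => /forallP/(_ i)/implyP + _ i2 => /(_ i2)/eqP. Qed.

Lemma gm_step p i j : (1 <= i)%N -> j = i.+1 :> nat -> (p i <= p j <= (p i).+1)%N.
Proof.
move=> i1 ji; case/andP: (gmP p) => _ /forallP/(_ i)/forallP/(_ j)/implyP.
by apply; rewrite i1 ji eqxx.
Qed.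

Definition perv_val (p : perversity n) (i : 'I_n.+1) : \bar int :=
  if p is GM q then (Posz (q i))%:E else +oo%E.

Definition perv_le (p q : perversity n) : bool :=
  [forall i, (perv_val p i <= perv_val q i)%E].

Lemma perv_leP (p q : perversity n) :
  reflect (forall i, (perv_val p i <= perv_val q i)%E) (perv_le p q).
Proof. exact: forallP. Qed.

Lemma perv_le_refl (p : perversity n) : perv_le p p.
Proof. by apply/perv_leP => i. Qed.

Lemma perv_le_trans (q p r : perversity n) : perv_le p q -> perv_le q r -> perv_le p r.
Proof. by move=> /perv_leP pq /perv_leP qr; apply/perv_leP => i; exact: le_trans (pq i) (qr i). Qed.

Lemma perv_le_infty (p : perversity n) : perv_le p Infty.
Proof. by apply/perv_leP => i; exact: leey. Qed.

Lemma perv_le_gm p q : perv_le (GM p) (GM q) = [forall i, (p i <= q i)%N].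
Proof. by apply: eq_forallb => i; rewrite /= lee_fin. Qed.

Lemma gm_inf_subproof p q (r := [ffun i => minn (p i) (q i)]) :
  [forall i : 'I_n.+1, (i <= 2)%N ==> (r i == 0%N)]
  && [forall i : 'I_n.+1, forall j : 'I_n.+1,
       (1 <= i)%N && (j == i.+1 :> nat) ==> (r i <= r j <= (r i).+1)%N].
Proof.
apply/andP; split; apply/forallP => i; first by apply/implyP => i2; rewrite ffunE !gm_small.
apply/forallP => j; apply/implyP => /andP[i1 /eqP ij]; rewrite !ffunE.
by have := gm_step p i1 ij; have := gm_step q i1 ij; lia.
Qed.

Definition gm_inf p q : gm_perversity n := GMPerversity (gm_inf_subproof p q).

Lemma gm_inf_l p q : perv_le (GM (gm_inf p q)) (GM p).
Proof. by rewrite perv_le_gm; apply/forallP => i; rewrite ffunE geq_minl. Qed.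

Lemma gm_inf_r p q : perv_le (GM (gm_inf p q)) (GM q).
Proof. by rewrite perv_le_gm; apply/forallP => i; rewrite ffunE geq_minr. Qed.

Lemma gm_inf_glb p q r : perv_le (GM r) (GM p) -> perv_le (GM r) (GM q) ->
  perv_le (GM r) (GM (gm_inf p q)).
Proof.
rewrite !perv_le_gm => /forallP rp /forallP rq; apply/forallP => i.
by rewrite ffunE leq_min rp rq.
Qed.

Definition peak p j : bool :=
  [&& (3 <= j < n)%N, p (inord j.+1) == p j & (p (inord j.-1) < p j)%N]
  || ((j == n :> nat) && (p (inord j.-1) < p j)%N).

Definition peak_of p := {j : 'I_n.+1 | peak p j}.

Lemma peak_lt p (x : peak_of p) : (p (inord (val x).-1) < p (val x))%N.
Proof. by case: x => x /= /orP[/and3P[]|/andP[]]. Qed.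

Lemma predecessor_subproof p (x : peak_of p)
    (r := [ffun i => if i == val x then (p i).-1 else p i]) :
  [forall i : 'I_n.+1, (i <= 2)%N ==> (r i == 0%N)]
  && [forall i : 'I_n.+1, forall j : 'I_n.+1,
       (1 <= i)%N && (j == i.+1 :> nat) ==> (r i <= r j <= (r i).+1)%N].
Proof.
apply/andP; split; apply/forallP => i.
  by apply/implyP => i2; rewrite ffunE gm_small ?if_same.
apply/forallP => j; apply/implyP => /andP[i1 /eqP ij]; rewrite !ffunE.
have pij := gm_step p i1 ij; have px := peak_lt x.
case: eqP => [ix|_]; case: eqP => [jx|_] //.
- by move: ij; rewrite ix jx => /eqP; rewrite ltn_eqF.
- rewrite -ix in px; suff /eqP pE : p j == p i by lia.
  have xn : (i < n)%N by have := ltn_ord j; rewrite ij ltnS.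
  have := valP x; rewrite -ix /peak => /orP[/and3P[_ + _]|/andP[/eqP iE _]].
    by move/eqP <-; apply/eqP; congr (p _); apply: val_inj; rewrite /= inordK -ij.
  by move: xn; rewrite iE ltnn.
- rewrite -jx in px; suff E : inord j.-1 = i by rewrite E in px; lia.
  by rewrite ij; exact: inord_val.
Qed.

Definition predecessor p (x : peak_of p) : gm_perversity n :=
  GMPerversity (predecessor_subproof x).

Lemma predecessor_le p (x : peak_of p) : perv_le (GM (predecessor x)) (GM p).
Proof.
rewrite perv_le_gm; apply/forallP => i; rewrite ffunE.
by case: eqP => // _; exact: leq_pred.
Qed.
End Perversities.

Record perverse_complex (n : nat) := PerverseComplex {
  pc_obj :> perversity n -> cochain;
  pc_map : forall q p, perv_le q p -> cmap (pc_obj q) (pc_obj p);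
  pc_map_id : forall p (pp : perv_le p p) k x, pc_map pp k x = x;
  pc_map_comp : forall q p r (qp : perv_le q p) (pr : perv_le p r)
    (qr : perv_le q r) k x, pc_map qr k x = pc_map pr k (pc_map qp k x) }.
Arguments pc_map {n} p0 {q p} _.

Section CohomologyPerverse.
Variables (n : nat) (A : perverse_complex n).

Definition coh_perverse : perverse_complex n.
exists (fun p => coh_cochain (A p)) (fun q p qp => coh_cmap (pc_map A qp)).
- move=> p pp k x; have [y ->] := qpi_surj x.
  apply: (etrans (coh_mapE _ _)); congr (qpi _ _); apply: val_inj.
  exact: pc_map_id.
- move=> q p r qp pr qr k x; have [y ->] := qpi_surj x.
  change (coh_map (pc_map A qr) k (qpi _ y)
    = coh_map (pc_map A pr) k (coh_map (pc_map A qp) k (qpi _ y))).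
  rewrite !coh_mapE; congr (qpi _ _); apply: val_inj.
  exact: pc_map_comp.
Defined.
End CohomologyPerverse.

Section PerverseBlowup.
Variables (F : universal_system) (n : nat) (K : filtered_face_set n).

Definition perverse_cond (q : perversity n) (k : nat) : subspace (blowup F K k).
exists (fun w : blowup F K k => forall l : 'I_n.+1, (0 < l)%N ->
  (norm l w <= perv_val q l)%E /\ (norm l (cdiff k w) <= perv_val q l)%E).
- by move=> l _; rewrite linear0; split; exact: norm0_le.
- move=> a x y xq yq l l0; rewrite linearP.
  by have [? ?] := xq _ l0; have [? ?] := yq _ l0; split; exact: norm_lin_le.
Defined.

Lemma perverse_cond_diff q k w :
  perverse_cond q k w -> perverse_cond q k.+1 (cdiff k w).
Proof.
move=> wq l l0; have [_ dwq] := wq _ l0; split; first exact: dwq.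
rewrite cdiffK; exact: norm0_le.
Qed.

Lemma perverse_cond_le q p k w :
  perv_le q p -> perverse_cond q k w -> perverse_cond p k w.
Proof.
move=> /perv_leP qp wq l l0; have [wl dwl] := wq _ l0.
by split; [exact: le_trans wl (qp l)|exact: le_trans dwl (qp l)].
Qed.

Definition perverse_incl q p (qp : perv_le q p) :
  cmap (subcomplex (@perverse_cond_diff q)) (subcomplex (@perverse_cond_diff p)).
exists (fun k => @sub_map _ _ _ _ idfun (fun w => @perverse_cond_le q p k w qp)).
by move=> k x; exact: val_inj.
Defined.

Definition perverse_blowup : perverse_complex n.
exists (fun q => subcomplex (@perverse_cond_diff q)) perverse_incl.
- by move=> p pp k x; exact: val_inj.
- by move=> q p r qp pr qr k x; exact: val_inj.
Defined.
End PerverseBlowup.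

Section Balanced.
Variables (n : nat) (A : perverse_complex n).

Section Sequence.
(* Predecessors are indexed by their peaks.  The sequence nu has length
   j = r + 1, so that k <= p(n_{nu_j}) - j + 1 reads k + r <= p(n_{nu_j}). *)
Variables (p : gm_perversity n) (r : nat) (nu : 'I_r.+1 -> peak_of p) (k : nat).

Local Notation pr i := (predecessor (nu i)).
Local Notation pr2 i l := (gm_inf (predecessor (nu i)) (predecessor (nu l))).

(* The summand of index i < l is sent to its i-th entry with sign + and to its
   l-th entry with sign -. *)
Definition balanced_phi (b : forall i l : 'I_r.+1, (i < l)%N -> A (GM (pr2 i l)) k)
    (h : 'I_r.+1) : A (GM (pr h)) k :=
  \sum_(l : {l : 'I_r.+1 | (h < l)%N})
     pc_map A (gm_inf_l (pr h) (pr (val l))) k (b h (val l) (valP l))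
  - \sum_(i : {i : 'I_r.+1 | (i < h)%N})
     pc_map A (gm_inf_r (pr (val i)) (pr h)) k (b (val i) h (valP i)).

Definition balanced_psi (a : forall i, A (GM (pr i)) k) : A (GM p) k :=
  \sum_i pc_map A (predecessor_le (nu i)) k (a i).

Definition balanced_exact : Prop :=
  forall a : forall i, A (GM (pr i)) k,
    balanced_psi a = 0 <-> exists b, forall h, balanced_phi b h = a h.
End Sequence.

Definition balanced : Prop :=
  forall p : gm_perversity n,
  [/\ forall r (nu : 'I_r.+1 -> peak_of p),
        (forall i l : 'I_r.+1, (i < l)%N -> (val (nu i) < val (nu l))%N) ->
        (forall k, (k + r <= p (val (nu ord_max)))%N -> balanced_exact nu k)
        /\ ((2 <= p (val (nu ord_max)))%N ->
            forall y, exists x,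
              pc_map A (predecessor_le (nu ord_max)) 0%N x = y)
    & forall q (qp : perv_le (GM q) (GM p)),
        injective (coh_map (pc_map A qp) 1)
        /\ injective (coh_map (pc_map A (perv_le_infty (GM q))) 1)].
End Balanced.

(* Main.v *)
(* An element of degree k has all its perverse norms at most k, so in low degree
   the conditions defining the subcomplex of a predecessor at its own peak are
   void.  Hence, with j predecessors and k <= p(n_j) - j + 1, a relation
   sum_i [w_i] = [d eta] forces w_i into the subcomplex of the last predecessor
   for i < j; the i-th summand is then lifted to the infimum of the i-th and
   last predecessors, and the last summand is recovered from the injectivity of
   H^k(A_{p_j}) -> H^k(A_p). *)
From mathcomp Require Import all_boot all_order all_algebra.
From mathcomp Require Import zify.
From mathcomp Require Import boolp constructive_ereal.
Require Import Defs.

Set Implicit Arguments.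
Unset Strict Implicit.
Unset Printing Implicit Defensive.
Import Order.TTheory GRing.Theory Num.Theory.
Local Open Scope ring_scope.

Lemma linear_ker0_inj (U V : vect) (f : {linear U -> V}) :
  (forall x, f x = 0 -> x = 0) -> injective f.
Proof.
move=> f0 x y fxy; apply/eqP; rewrite -subr_eq0; apply/eqP/f0.
by rewrite linearB fxy subrr.
Qed.

(** With zero differentials every coboundary is 0, so taking cohomology again identifies nothing. *)
Lemma coh_map_coh_inj (A B : cochain) (f : cmap (coh_cochain A) (coh_cochain B)) k :
  injective (f k) -> injective (coh_map f k).
Proof.
move=> fI; apply: linear_ker0_inj => x; have [y ->] := qpi_surj x.
rewrite coh_mapE => /qpi_eq0 [z zE].
suff y0 : val y = 0 by have -> : y = 0 by [apply: val_inj]; rewrite linear0.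
apply: fI; rewrite linear0; move: zE => /= <-.
by case: (k) z => [|j] z.
Qed.

(** Turns the dependent sums of [balanced_phi] into ordinary double sums, whose order can be
    exchanged. *)
Lemma sum_sig (I : finType) (P : pred I) (V : nmodType)
    (G : forall i, P i -> V) :
  \sum_(x : {i | P i}) G (val x) (valP x) =
  \sum_(i | P i) oapp (fun x : {i | P i} => G (val x) (valP x)) 0 (insub i).
Proof.
rewrite (reindex_omap (val : {i | P i} -> I) insub) /= => [|i Pi]; last by rewrite insubT.
apply: eq_big => [x|x _]; last by rewrite valK.
by rewrite (valP x) valK eqxx.
Qed.

(** * Exactness in an arbitrary perverse complex *)

Section Exactness.
Variables (n : nat) (A : perverse_complex n) (p : gm_perversity n) (r : nat).
Variables (nu : 'I_r.+1 -> peak_of p) (k : nat).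

(** By functoriality the two images of an entry of [b] in [A (GM p)] agree; they occur with opposite
    signs and cancel. *)
Lemma balanced_psi_phi
    (b : forall i l : 'I_r.+1, (i < l)%N ->
       A (GM (gm_inf (predecessor (nu i)) (predecessor (nu l)))) k) :
  balanced_psi (balanced_phi b) = 0.
Proof.
pose pr i := predecessor (nu i).
have le i l : perv_le (GM (gm_inf (pr i) (pr l))) (GM p).
  exact: perv_le_trans (gm_inf_l _ _) (predecessor_le _).
pose G (i l : 'I_r.+1) (il : (i < l)%N) := pc_map A (le i l) k (b i l il).
pose g (i l : 'I_r.+1) :=
  oapp (fun x : {l : 'I_r.+1 | (i < l)%N} => G i (val x) (valP x)) 0 (insub l).
have gE (i l : 'I_r.+1) (il : (i < l)%N) : g i l = G i l il.
  by rewrite /g insubT /=; congr G; exact: bool_irrelevance.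
transitivity (\sum_(h < r.+1) (\sum_(l : 'I_r.+1 | (h < l)%N) g h l
                      - \sum_(i : 'I_r.+1 | (i < h)%N) g i h)).
  apply: eq_bigr => h _; rewrite linearB; congr (_ - _).
    rewrite linear_sum /g -sum_sig; apply: eq_bigr => l _.
    by rewrite -(@pc_map_comp _ A _ _ _ _ _ (le h (val l))).
  rewrite linear_sum.
  transitivity (\sum_(x : {i : 'I_r.+1 | (i < h)%N}) G (val x) h (valP x)).
    apply: eq_bigr => i _.
    by rewrite -(@pc_map_comp _ A _ _ _ _ _ (le (val i) h)).
  rewrite (sum_sig (fun i ih => G i h ih)); apply: eq_bigr => i ih.
  by rewrite insubT /= gE; congr G; exact: bool_irrelevance.
by rewrite sumrB [X in X - _](exchange_big_dep predT) //= subrr.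
Qed.

(** Take [b] supported on the pairs (i, [ord_max]), made of the given lifts. Then [balanced_phi b]
    and [a] agree off [ord_max] and both are killed by [balanced_psi], so injectivity settles the
    last entry. *)
Lemma balanced_exact_last :
  injective (pc_map A (predecessor_le (nu ord_max)) k) ->
  (forall a, balanced_psi a = 0 -> forall i : 'I_r.+1, (i < (ord_max : 'I_r.+1))%N ->
     exists x, pc_map A (gm_inf_l (predecessor (nu i)) (predecessor (nu ord_max))) k x
               = a i) ->
  balanced_exact A nu k.
Proof.
move=> maxI lift a; split=> [a0|[b bE]]; last first.
  by rewrite -(balanced_psi_phi b); apply: eq_bigr => i _; rewrite bE.
have cP (i l : 'I_r.+1) (il : (i < l)%N) :
    exists x : A (GM (gm_inf (predecessor (nu i)) (predecessor (nu l)))) k,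
    pc_map A (gm_inf_l _ _) k x = (if l == ord_max then a i else 0)
    /\ (l != ord_max -> x = 0).
  have [lm|lm] := eqVneq l ord_max; last by exists 0; rewrite linear0.
  by subst l; have [x xE] := lift a a0 i il; exists x.
pose b (i l : 'I_r.+1) (il : (i < l)%N) := projT1 (cid (cP i l il)).
have bP (i l : 'I_r.+1) (il : (i < l)%N) := projT2 (cid (cP i l il)).
have bE (h : 'I_r.+1) : h != ord_max -> balanced_phi b h = a h.
  move=> hm; have h_lt : (h < (ord_max : 'I_r.+1))%N.
    by rewrite ltn_neqAle leq_ord andbT.
  (* No pair ending in [h] ends in [ord_max], so the negative sum vanishes; the positive one keeps
     only l = [ord_max]. *)
  rewrite /balanced_phi [X in _ - X]big1 => [|i _]; last first.
    by rewrite (_ : b _ _ _ = 0) ?linear0 //; case: (bP _ _ (valP i)) => _; exact.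
  rewrite subr0 (bigD1 (exist (fun l : 'I_r.+1 => h < l)%N ord_max h_lt)) //=.
  rewrite big1 => [|l lm]; last first.
    rewrite (_ : b _ _ _ = 0) ?linear0 //; case: (bP _ _ (valP l)) => _; apply.
    by apply: contra lm => /eqP lm; apply/eqP/val_inj.
  rewrite addr0; set il := valP _; have -> : il = h_lt by exact: bool_irrelevance.
  by apply: etrans (proj1 (bP _ _ h_lt)) _; rewrite eqxx.
exists b => h; have [->|] := eqVneq h ord_max; last exact: bE.
have := balanced_psi_phi b; rewrite -a0 /balanced_psi.
rewrite (bigD1 ord_max) //= [RHS](bigD1 ord_max) //=.
rewrite [X in _ + X = _](eq_bigr (fun i => pc_map A (predecessor_le (nu i)) k (a i))).
  by move/addIr/maxI.
by move=> i im; rewrite bE.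
Qed.
End Exactness.

(** * Perverse norms bounded by the degree *)

Section Norm.
Variables (F : universal_system) (n : nat) (K : filtered_face_set n).

(** A non-zero component has multidegree of sum k, and its tail degree is a partial sum. *)
Lemma norm_le_degree (l : 'I_n.+1) k (w : blowup F K k) :
  (norm l w <= (Posz k)%:E)%E.
Proof.
apply/norm_leP => s e _ we; rewrite lee_fin lez_nat.
have <- : (\sum_i e i)%N = k.
  apply/eqP; apply: contra_notT we => ek.
  exact: (sub_memE (restrict F l (sp_obj s) k (val w s))).
by rewrite /tail_degree [leqRHS](bigID (fun i : 'I_n.+1 => rev_ord l < i)%N) leq_addr.
Qed.

Lemma perverse_cond_predecessor (p : gm_perversity n) (x : peak_of p) k
    (w : blowup F K k) :
  perverse_cond F K (GM p) k w ->
  (norm (val x) w <= (Posz (p (val x)).-1)%:E)%E ->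
  (norm (val x) (cdiff k w) <= (Posz (p (val x)).-1)%:E)%E ->
  perverse_cond F K (GM (predecessor x)) k w.
Proof. by move=> wp wx dwx l l0; rewrite /= ffunE; case: eqP => [->|_] //; exact: wp. Qed.

Lemma norm_lt_le (l : 'I_n.+1) k (w : blowup F K k) m :
  (k < m)%N -> (norm l w <= (Posz m.-1)%:E)%E.
Proof.
by move=> km; apply: le_trans (norm_le_degree _ _) _; rewrite lee_fin lez_nat; lia.
Qed.

(** Both [w] and its differential have degree below [p (val x)], so the degree bound gives the
    lowered condition at the peak. *)
Lemma perverse_cond_low_degree (p : gm_perversity n) (x : peak_of p) k
    (w : blowup F K k) :
  (k.+1 < p (val x))%N -> perverse_cond F K (GM p) k w ->
  perverse_cond F K (GM (predecessor x)) k w.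
Proof.
move=> kp wp; apply: perverse_cond_predecessor => //; apply: norm_lt_le => //.
exact: ltnW.
Qed.

(** The degree bound controls only [w] here; the bound on its differential comes from the last
    hypothesis. *)
Lemma perverse_cond_primitive (p : gm_perversity n) (x : peak_of p) k
    (w : blowup F K k) :
  (k < p (val x))%N -> perverse_cond F K (GM p) k w ->
  perverse_cond F K (GM (predecessor x)) k.+1 (cdiff k w) ->
  perverse_cond F K (GM (predecessor x)) k w.
Proof.
move=> kp wp dwx; apply: perverse_cond_predecessor => //; first exact: norm_lt_le.
(* Perversity conditions concern positive indices only; a peak is positive because [p] increases
   there. *)
have x0 : (0 < val x)%N.
  by rewrite lt0n; apply/eqP => x0; have := peak_lt x; rewrite [X in (_ < X)%N]gm_small ?x0.
by have [+ _] := dwx _ x0; rewrite /= ffunE eqxx.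
Qed.

Lemma perverse_cond_inf (p q : gm_perversity n) k (w : blowup F K k) :
  perverse_cond F K (GM p) k w -> perverse_cond F K (GM q) k w ->
  perverse_cond F K (GM (gm_inf p q)) k w.
Proof.
move=> wp wq l l0; have [wl dwl] := wp _ l0; have [wl' dwl'] := wq _ l0.
by rewrite /= ffunE; case: leqP.
Qed.

(** In degree 0 norms are at most 0, hence below every GM-perversity; this yields injectivity on
    H^1. *)
Lemma perverse_cond_deg0 (q : gm_perversity n) (w : blowup F K 0) :
  perverse_cond F K (GM q) 1 (cdiff 0 w) -> perverse_cond F K (GM q) 0 w.
Proof.
move=> dwq l l0; have [dwl _] := dwq _ l0; split=> //.
by apply: le_trans (norm_le_degree _ _) _; rewrite lee_fin.
Qed.
End Norm.

(** * The blow-up and its cohomology *)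

Section BalancedBlowup.
Variables (F : universal_system) (n : nat) (K : filtered_face_set n).
Local Notation A := (perverse_blowup F K).
Local Notation H := (coh_perverse A).

Lemma perverse_incl_inj q p (qp : perv_le q p) k : injective (pc_map A qp k).
Proof. by move=> x y /(congr1 val) xy; exact: val_inj. Qed.

(** By [prim], a primitive found in the larger subcomplex already lies in the smaller one. *)
Lemma coh_pc_map_inj q p (qp : perv_le q p) k :
  (forall w : A p k, perverse_cond F K q k.+1 (cdiff k (val w)) ->
     perverse_cond F K q k (val w)) ->
  injective (pc_map H qp k.+1).
Proof.
move=> prim; apply: linear_ker0_inj => x; have [z ->] := qpi_surj x.
rewrite [LHS]coh_mapE => /qpi_eq0 [y yz]; apply/qpi_eq0.
have {}yz : cdiff k (val y) = val (val z) by rewrite -[LHS]/(val (cdiff k y)) [cdiff k y]yz.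
have yq : perverse_cond F K q k (val y).
  by apply: prim; rewrite yz; exact: sub_memE.
by exists (msub yq); exact: val_inj.
Qed.

Lemma coh_pc_map_inj0 q p (qp : perv_le q p) : injective (pc_map H qp 0%N).
Proof.
apply: linear_ker0_inj => x; have [z ->] := qpi_surj x.
rewrite [LHS]coh_mapE => /qpi_eq0 [y yz]; apply/qpi_eq0; exists 0.
apply: val_inj; have /(congr1 val) := yz; exact.
Qed.

Lemma coh_pc_map_predecessor_inj (p : gm_perversity n) (x : peak_of p) k :
  (k <= p (val x))%N -> injective (pc_map H (predecessor_le x) k).
Proof.
case: k => [_|k kp]; first exact: coh_pc_map_inj0.
by apply: coh_pc_map_inj => w; apply: perverse_cond_primitive => //; exact: sub_memE.
Qed.

Section Sequence.
Variables (p : gm_perversity n) (r : nat) (nu : 'I_r.+1 -> peak_of p) (k : nat).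
Hypothesis kr : (k + r <= p (val (nu ord_max)))%N.
Local Notation pr i := (predecessor (nu i)).

(* With at least three predecessors the bound on k makes the condition at the
   last peak void; with two, the second summand determines the first. *)
Lemma perverse_cond_summand (w : 'I_r.+1 -> blowup F K k) :
  (forall i, perverse_cond F K (GM (pr i)) k (w i)) ->
  perverse_cond F K (GM (pr ord_max)) k (\sum_i w i) ->
  forall i : 'I_r.+1, (i < (ord_max : 'I_r.+1))%N ->
  perverse_cond F K (GM (pr ord_max)) k (w i).
Proof.
move=> wP sP i im; have [r1|r1] := leqP r 1; last first.
  apply: perverse_cond_low_degree; first lia.
  exact: perverse_cond_le (predecessor_le _) (wP i).
(* Here [im] excludes r = 0, so r = 1 and [i] is the only index besides [ord_max]. *)
have -> : w i = \sum_i w i - w ord_max.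
  rewrite (bigD1 ord_max) //= [w ord_max + _]addrC addrK (big_pred1 i) // => j /=.
  apply/idP/eqP => [jm|->]; last by rewrite neq_ltn im.
  by apply: val_inj; move: jm im (ltn_ord j); rewrite -val_eqE /=; lia.
exact: (smemD sP (smemN (wP ord_max))).
Qed.

(** The structure maps are inclusions, so a lift to the infimum amounts to membership in both
    subcomplexes. *)
Lemma blowup_balanced_exact : balanced_exact A nu k.
Proof.
apply: balanced_exact_last; first exact: perverse_incl_inj.
move=> a a0 i im.
have s0 : \sum_i val (a i) = 0.
  by rewrite -[RHS]/(val (0 : A (GM p) k)) -a0 raddf_sum.
have wi : perverse_cond F K (GM (pr ord_max)) k (val (a i)).
  apply: (perverse_cond_summand (w := fun i => val (a i))) im.
    by move=> j; exact: sub_memE.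
  by rewrite s0; exact: smem0.
by exists (msub (perverse_cond_inf (sub_memE (a i)) wi)); exact: val_inj.
Qed.

Lemma coh_blowup_balanced_exact : balanced_exact H nu k.
Proof.
apply: balanced_exact_last.
  by apply: coh_pc_map_predecessor_inj; lia.
move=> a a0 i im.
have zP j : exists z, a j = qpi _ z by exact: qpi_surj.
pose z j := projT1 (cid (zP j)); have zE j : a j = qpi _ (z j) := projT2 (cid (zP j)).
have [y yE] : exists y, val (cdiff_to (A (GM p)) k y) = \sum_j val (val (z j)).
  have : qpi (coboundaries (A (GM p)) k)
      (\sum_j sub_map (@cmap_cocycle _ _ (pc_map A (predecessor_le (nu j))) k) (z j)) = 0.
    rewrite linear_sum -[RHS]a0; apply: eq_bigr => j _.
    by rewrite zE [RHS]coh_mapE.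
  by move/qpi_eq0 => [y yE]; exists y; rewrite yE !raddf_sum.
(* By [im], r is at least 1, so the degree of [y] is low enough for [y] to lie in the last
   predecessor's subcomplex; for k = 0 the sum is 0. *)
have sP : perverse_cond F K (GM (pr ord_max)) k (\sum_j val (val (z j))).
  rewrite -yE; case: (k) kr y {yE} => [|k'] kr' y; first exact: smem0.
  apply: perverse_cond_diff; apply: perverse_cond_low_degree; last exact: sub_memE.
  by move: im kr' => /=; lia.
have wi : perverse_cond F K (GM (pr ord_max)) k (val (val (z i))).
  apply: (perverse_cond_summand (w := fun i => val (val (z i)))) im => // j.
  exact: sub_memE.
(* The chosen representative itself lifts, without correction by a coboundary. *)
pose x := msub (perverse_cond_inf (sub_memE (val (z i))) wi) :
  A (GM (gm_inf (pr i) (pr ord_max))) k.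
have xc : cocycles (A (GM (gm_inf (pr i) (pr ord_max)))) k x.
  by apply: val_inj; have /(congr1 val) := sub_memE (z i).
exists (qpi _ (msub xc)); rewrite [LHS]coh_mapE zE; congr (qpi _ _).
by apply: val_inj; apply: val_inj.
Qed.
End Sequence.

Lemma coh_pc_map1_inj (q : gm_perversity n) p (qp : perv_le (GM q) p) :
  injective (pc_map H qp 1).
Proof. by apply: coh_pc_map_inj => w; exact: perverse_cond_deg0. Qed.

Lemma predecessor_deg0_surj (p : gm_perversity n) (x : peak_of p) :
  (2 <= p (val x))%N -> forall y, exists z, pc_map A (predecessor_le x) 0%N z = y.
Proof.
move=> p2 y; have yp := perverse_cond_low_degree p2 (sub_memE y).
by exists (msub yp); exact: val_inj.
Qed.

Lemma coh_predecessor_deg0_surj (p : gm_perversity n) (x : peak_of p) :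
  (2 <= p (val x))%N -> forall y, exists z, pc_map H (predecessor_le x) 0%N z = y.
Proof.
move=> p2 y; have [c ->] := qpi_surj y.
have [z zE] := predecessor_deg0_surj p2 (val c).
have zc : cocycles (A (GM (predecessor x))) 0 z.
  apply: val_inj; have /(congr1 val) := sub_memE c.
  by rewrite -zE.
by exists (qpi _ (msub zc)); rewrite [LHS]coh_mapE; congr (qpi _ _); exact: val_inj.
Qed.
End BalancedBlowup.

Theorem proposition2p23 (F : universal_system) (n : nat) (K : filtered_face_set n) :
  balanced (perverse_blowup F K) /\ balanced (coh_perverse (perverse_blowup F K)).
Proof.
split=> p; split=> [r nu _|q qp].
- split; last exact: predecessor_deg0_surj.
  by move=> k; exact: blowup_balanced_exact.
- by split; exact: coh_pc_map1_inj.
- split; last exact: coh_predecessor_deg0_surj.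
  by move=> k; exact: coh_blowup_balanced_exact.
- by split; apply: coh_map_coh_inj; exact: coh_pc_map1_inj.
Qed.
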